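(* Let $A$ be a commutative ring with unity, let $n\geq 1$, and let $f(t)=t^n-f_1t^{n-1}+f_2t^{n-2}-\cdots+(-1)^nf_n$ be a monic polynomial with coefficients in $A$. Let $A_f=A[\tau_1,\dots,\tau_n]$ be the splitting algebra of $f$ over $A$ with universal roots $\tau_1,\dots,\tau_n$. Assume that at least one of the following two conditions holds: (1) the element $2$ is regular in $A$; (2) the element $\prod_{i\neq j}(\tau_i-\tau_j)$ (product over all ordered pairs $(i,j)$ with $1\le i,j\le n$, $i\ne j$) is regular in $A_f$. Then $A$ is the ring of invariants of $A_f$ under the action of the symmetric group $\mathfrak S_n$.
   Context: Rings are commutative with unity. An element of a ring is regular if it is neither zero nor a zero divisor. Splitting algebra: for $f(t)=t^n-f_1t^{n-1}+\cdots+(-1)^nf_n$ in $A[t]$, $A_f$ is the quotient of the polynomial ring $A[t_1,\dots,t_n]$ by the ideal generated by $s_1-f_1,\dots,s_n-f_n$, where $s_1,\dots,s_n$ are the elementary symmetric functions of $t_1,\dots,t_n$. The universal roots $\tau_1,\dots,\tau_n$ are the classes of $t_1,\dots,t_n$; thus $f(t)=(t-\tau_1)\cdots(t-\tau_n)$ in $A_f[t]$. Action: $\mathfrak S_n$ is the group of permutations of $\{1,\dots,n\}$; each $\sigma\in\mathfrak S_n$ acts on $A_f$ by the $A$-algebra automorphism $\varphi_\sigma$ determined by $\varphi_\sigma(\tau_i)=\tau_{\sigma^{-1}(i)}$. The ring of invariants is the subring of elements fixed by all $\varphi_\sigma$. ''$A$ is the ring of invariants'' means that the structure map $A\to A_f$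 is injective with image the ring of invariants. *)

(* Defs.v *)
From HB Require Import structures.
From mathcomp Require Import all_boot all_order all_fingroup all_algebra.
From mathcomp Require Import boolp.
From mathcomp Require Export mpoly.

Set Implicit Arguments.
Unset Strict Implicit.
Unset Printing Implicit Defensive.

Import GRing.Theory.

Local Open Scope ring_scope.
Local Open Scope quotient_scope.

Definition zero_divisor (R : comNzRingType) (x : R) : Prop :=
  exists y : R, y <> 0 /\ x * y = 0.

Definition regular (R : comNzRingType) (x : R) : Prop :=
  x <> 0 /\ ~ zero_divisor x.

Section SplittingIdeal.
Variables (A : comNzRingType) (n : nat) (f : {poly A}).

(* The sign makes f = \sum_(k <= n) (-1)^k f_k 'X^(n - k) for f monic of      *)
(* degree n.                                                                  *)
Definition signed_coef (k : nat) : A := (-1) ^+ k * f`_(n - k).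

Definition splitting_gen (i : 'I_n) : {mpoly A[n]} :=
  mesym n A i.+1 - (signed_coef i.+1)%:MP.

(* Quotients in MathComp are taken by boolean predicates, whence the          *)
(* classical reflection of membership in the ideal.                           *)
Definition splitting_ideal : pred {mpoly A[n]} := fun p =>
  `[< exists c : 'I_n -> {mpoly A[n]}, p = \sum_i c i * splitting_gen i >].

End SplittingIdeal.

Arguments signed_coef {A} n f k.
Arguments splitting_gen {A n} f i.
Arguments splitting_ideal {A} n f.

Lemma comring_roots_coef (A S : comNzRingType) (g : {rmorphism A -> S}) n
    (r : 'I_n -> S) (k : 'I_n.+1) :
  (\prod_(i < n) ('X - (r i)%:P))`_(n - k) =
  (-1) ^+ k * mmap g r (mesym n A k).
Proof.
pose h : {mpoly int[n]} -> S := mmap intr r.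
move: (Viete n) => /(congr1 (map_poly h)).
rewrite rmorph_prod /=.
under eq_bigr => i _ do
  rewrite raddfB /= map_polyX map_polyC /= /h mmapX mmap1U.
move=> ->; rewrite raddf_sum coef_sum /=.
rewrite (bigD1 k) //= big1 ?addr0; last first.
  move=> i ne_ik; rewrite !map_polyZ /= map_polyXn !coefZ coefXn.
  rewrite (_ : (n - k == n - i)%N = false) ?mulr0 //.
  apply: contraNF ne_ik => /eqP e; apply/eqP/val_inj => /=.
  have := ltn_ord i; have := ltn_ord k; rewrite !ltnS => lek lei.
  by rewrite -(subKn lei) -e subKn.
rewrite !map_polyZ !rmorphXn /= raddfN /= mmapC !coefZ /=.
congr (_ * _); rewrite map_polyX coefXn eqxx mulr1.
rewrite /mesym !raddf_sum /=; apply: eq_bigr => H _.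
rewrite !rmorph_prod /=; apply: eq_bigr => j _.
by rewrite /h !mmapX !mmap1U.
Qed.

Lemma monic_splits n (A : comNzRingType) (p : {poly A}) :
  p \is monic -> size p = n.+1 ->
  exists (S : comNzRingType) (g : {rmorphism A -> S}) (r : 'I_n -> S),
    map_poly g p = \prod_(i < n) ('X - (r i)%:P).
Proof.
elim: n A p => [|n IHn] A p p_mon sp.
  exists A, idfun, (fun=> 0); rewrite big_ord0 map_poly_id //.
  have /size_poly1P[c _ ep] : size p == 1%N by rewrite sp.
  by move: p_mon; rewrite ep monicE lead_coefC => /eqP->.
pose B : comNzRingType := {poly %/ p}.
pose h : {rmorphism A -> B} := qpolyC p.
have hp : mk_monic p = p by rewrite /mk_monic sp p_mon.
have hE (q : {poly A}) : (map_poly h q).[in_qpoly p 'X] = in_qpoly p q.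
  elim/poly_ind: q => [|q c IHq]; first by rewrite !rmorph0 horner0.
  rewrite !rmorphD !rmorphM /= map_polyX map_polyC hornerMXaddC IHq.
  congr (_ + _); apply: val_inj; rewrite /= Pdiv.CommonRing.rmodp_small //.
  by rewrite (leq_ltn_trans (size_polyC_leq1 _)) ?size_mk_monic_gt1.
have /factor_theorem[q eq_q] : root (map_poly h p) (in_qpoly p 'X).
  rewrite /root hE; apply/eqP/val_inj; rewrite /= hp.
  exact: Pdiv.RingMonic.rmodpp p_mon.
have hp_mon : map_poly h p \is monic by exact: monic_map.
have q_mon : q \is monic.
  by move: hp_mon; rewrite eq_q monicMr ?monicXsubC.
have sq : size q = n.+1.
  have := congr1 (fun P : {poly B} => size P) eq_q.
  rewrite size_map_poly_id0 ?(monicP p_mon) ?rmorph1 ?oner_neq0 // sp.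
  by rewrite size_Mmonic ?monicXsubC ?monic_neq0 // size_XsubC addn2 => -[].
have [S [g [r eq_r]]] := IHn B q q_mon sq.
exists S, (g \o h : {rmorphism A -> S}).
exists (fun i : 'I_n.+1 => if unlift ord_max i is Some j then r j
                           else g (in_qpoly p 'X)).
rewrite map_poly_comp eq_q rmorphM /= eq_r big_ord_recr /= unlift_none.
congr (_ * _); last by rewrite rmorphB /= map_polyX map_polyC.
apply: eq_bigr => i _; rewrite (_ : widen_ord _ i = lift ord_max i) ?liftK //.
by apply: val_inj; rewrite /= /bump leqNgt ltn_ord.
Qed.

Section SplittingIdealTheory.
Variables (A : comNzRingType) (n : nat) (f : {poly A}).

Lemma splitting_idealP (p : {mpoly A[n]}) :
  reflect (exists c : 'I_n -> {mpoly A[n]}, p = \sum_i c i * splitting_gen f i)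
          (p \in splitting_ideal n f).
Proof. exact: asboolP. Qed.

Lemma splitting_gen_ideal (i : 'I_n) :
  splitting_gen f i \in splitting_ideal n f.
Proof.
apply/splitting_idealP; exists (fun j => (j == i)%:R).
rewrite (bigD1 i) //= eqxx mul1r big1 ?addr0 // => j /negPf->.
by rewrite mul0r.
Qed.

Lemma splitting_ideal_proper : 1 \notin splitting_ideal n f.
Proof.
pose p : {poly A} := 'X^n + \poly_(i < n) f`_i.
have lt_p : (size (\poly_(i < n) f`_i)%R < size ('X^n : {poly A}))%N.
  by rewrite size_polyXn ltnS size_poly.
have p_mon : p \is monic by rewrite monicE lead_coefDl // lead_coefXn.
have sp : size p = n.+1 by rewrite size_polyDl // size_polyXn.
have [S [g [r eq_r]]] := monic_splits p_mon sp.
apply/negP => /splitting_idealP[c /(congr1 (mmap g r))].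
rewrite rmorph1 rmorph_sum big1 => [/eqP|i _]; first by rewrite oner_eq0.
rewrite /= rmorphM rmorphB /= mmapC /signed_coef.
have lt_i : (n - i.+1 < n)%N by rewrite ltn_subrL (leq_ltn_trans _ (ltn_ord i)).
have := comring_roots_coef g r (lift ord0 i : 'I_n.+1).
rewrite lift0 -eq_r coef_map /p coefD coefXn coef_poly lt_i ltn_eqF // add0r => e.
have gM x : g ((-1) ^+ i.+1 * x) = (-1) ^+ i.+1 * g x.
  by rewrite rmorphM rmorph_sign.
by rewrite [X in _ - X]gM e mulrA -exprMn mulrNN mulr1 expr1n mul1r subrr mulr0.
Qed.

Lemma splitting_ideal_closed : idealr_closed (splitting_ideal n f).
Proof.
split=> [||a p q /splitting_idealP[c ->] /splitting_idealP[d ->]].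
- by apply/splitting_idealP; exists (fun=> 0);
    rewrite big1 // => i _; rewrite mul0r.
- exact: splitting_ideal_proper.
apply/splitting_idealP; exists (fun i => a * c i + d i).
by rewrite mulr_sumr -big_split /=; apply: eq_bigr => i _; rewrite mulrDl mulrA.
Qed.

HB.instance Definition _ :=
  isIdealr.Build {mpoly A[n]} (splitting_ideal n f) splitting_ideal_closed.

End SplittingIdealTheory.

Section SplittingAlgebra.
Variables (A : comNzRingType) (n : nat) (f : {poly A}).

Definition splitting_algebra : Type :=
  {ideal_quot (splitting_ideal n f : idealr {mpoly A[n]})}.

HB.instance Definition _ := GRing.ComNzRing.on splitting_algebra.

Definition splitting_proj : {mpoly A[n]} -> splitting_algebra :=
  \pi_{ideal_quot (splitting_ideal n f : idealr {mpoly A[n]})}.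

HB.instance Definition _ := GRing.RMorphism.on splitting_proj.

Definition splitting_repr (x : splitting_algebra) : {mpoly A[n]} := generic_quotient.repr x.

Lemma splitting_reprK : cancel splitting_repr splitting_proj.
Proof. exact: reprK. Qed.

Lemma splitting_proj_eq (p q : {mpoly A[n]}) :
  (splitting_proj p == splitting_proj q) = (p - q \in splitting_ideal n f).
Proof. by rewrite Quotient.idealrBE. Qed.

Definition splitting_scale (a : A) (x : splitting_algebra) : splitting_algebra :=
  splitting_proj a%:MP * x.

Fact splitting_scaleA a b x :
  splitting_scale a (splitting_scale b x) = splitting_scale (a * b) x.
Proof. by rewrite /splitting_scale mulrA -rmorphM -mpolyCM. Qed.

Fact splitting_scale1 : left_id 1 splitting_scale.
Proof. by move=> x; rewrite /splitting_scale mpolyC1 rmorph1 mul1r. Qed.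

Fact splitting_scaleDr : right_distributive splitting_scale +%R.
Proof. by move=> a x y; rewrite /splitting_scale mulrDr. Qed.

Fact splitting_scaleDl x : {morph splitting_scale^~ x : a b / a + b}.
Proof. by move=> a b; rewrite /splitting_scale mpolyCD rmorphD mulrDl. Qed.

HB.instance Definition _ := GRing.Zmodule_isLmodule.Build A splitting_algebra
  splitting_scaleA splitting_scale1 splitting_scaleDr splitting_scaleDl.

Fact splitting_scaleAl (a : A) (x y : splitting_algebra) :
  a *: (x * y) = (a *: x) * y.
Proof. exact: mulrA. Qed.

HB.instance Definition _ :=
  GRing.Lmodule_isLalgebra.Build A splitting_algebra splitting_scaleAl.
HB.instance Definition _ :=
  GRing.Lalgebra_isComAlgebra.Build A splitting_algebra.

Fact splitting_proj_scalable : scalable splitting_proj.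
Proof. by move=> a p; rewrite -mul_mpolyC rmorphM. Qed.

HB.instance Definition _ := GRing.isScalable.Build A {mpoly A[n]}
  splitting_algebra *:%R splitting_proj splitting_proj_scalable.

Lemma splitting_projC (a : A) : splitting_proj a%:MP = a%:A.
Proof. by rewrite -alg_mpolyC linearZ /= rmorph1. Qed.

Definition univ_root (i : 'I_n) : splitting_algebra := splitting_proj 'X_i.

Lemma splitting_gen_eq0 i : splitting_proj (splitting_gen f i) = 0.
Proof.
by apply/eqP; rewrite -(rmorph0 splitting_proj) splitting_proj_eq subr0
  splitting_gen_ideal.
Qed.

Lemma univ_root_prod : f \is monic -> size f = n.+1 ->
  map_poly (in_alg splitting_algebra) f = \prod_(i < n) ('X - (univ_root i)%:P).
Proof.
move=> f_mon sf; apply/polyP => j; rewrite coef_map /=.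
have [lt_nj|le_jn] := ltnP n j.
  rewrite !nth_default ?scale0r ?sf // size_prod_XsubC.
  by rewrite /index_enum -enumT size_enum_ord.
have lt_k : (n - j < n.+1)%N by rewrite ltnS leq_subr.
have := comring_roots_coef (in_alg splitting_algebra) univ_root (Ordinal lt_k).
rewrite /= subKn // => ->.
have -> : mmap (in_alg splitting_algebra) univ_root (mesym n A (n - j)) =
          splitting_proj (mesym n A (n - j)).
  rewrite /mesym !rmorph_sum; apply: eq_bigr => h _ /=.
  by rewrite !rmorph_prod; apply: eq_bigr => i _ /=; rewrite mmapX mmap1U.
have [->|ne_jn] := eqVneq j n.
  rewrite subnn mesym0E rmorph1 mul1r.
  by move: f_mon; rewrite monicE /lead_coef sf /= => /eqP->; rewrite scale1r.
have lt_jn : (j < n)%N by rewrite ltn_neqAle ne_jn.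
have lt_i : ((n - j).-1 < n)%N by rewrite prednK ?subn_gt0 // leq_subr.
have := splitting_gen_eq0 (Ordinal lt_i).
rewrite /splitting_gen rmorphB /= prednK ?subn_gt0 // => /eqP.
rewrite subr_eq0 => /eqP->; rewrite splitting_projC /signed_coef subKn //.
rewrite -signr_odd -(rmorph_sign (in_alg splitting_algebra)) signr_odd.
by rewrite -rmorphM mulrA -exprMn mulrNN mulr1 expr1n mul1r.
Qed.

(* msym s maps 'X_i to 'X_(s i), so this sends univ_root i to                 *)
(* univ_root (s^-1 i), see splitting_act_root.                                *)
Definition splitting_act (s : 'S_n) (x : splitting_algebra) : splitting_algebra :=
  splitting_proj (msym s^-1 (splitting_repr x)).

Lemma splitting_ideal_msym (s : 'S_n) (p : {mpoly A[n]}) :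
  p \in splitting_ideal n f -> msym s p \in splitting_ideal n f.
Proof.
move=> /splitting_idealP[c ->]; apply/splitting_idealP.
exists (fun i => msym s (c i)); rewrite rmorph_sum; apply: eq_bigr => i _ /=.
rewrite rmorphM; congr (_ * _); rewrite /splitting_gen rmorphB /=.
by rewrite (issymP _ (mesym_sym _ _ _)) /= -alg_mpolyC linearZ /= rmorph1.
Qed.

Lemma splitting_actE s (p : {mpoly A[n]}) :
  splitting_act s (splitting_proj p) = splitting_proj (msym s^-1 p).
Proof.
apply/eqP; rewrite splitting_proj_eq -rmorphB splitting_ideal_msym //.
by rewrite -splitting_proj_eq splitting_reprK.
Qed.

Fact splitting_act_linear s : linear (splitting_act s).
Proof.
move=> a x y; rewrite -(splitting_reprK x) -(splitting_reprK y).
by rewrite -linearP !splitting_actE !linearP.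
Qed.

Fact splitting_act_monoid_morphism s : monoid_morphism (splitting_act s).
Proof.
split=> [|x y].
  by rewrite -(rmorph1 splitting_proj) splitting_actE !rmorph1.
rewrite -(splitting_reprK x) -(splitting_reprK y).
by rewrite -rmorphM !splitting_actE !rmorphM.
Qed.

HB.instance Definition _ s := GRing.isLinear.Build A splitting_algebra
  splitting_algebra *:%R (splitting_act s) (splitting_act_linear s).
HB.instance Definition _ s := GRing.isMonoidMorphism.Build splitting_algebra
  splitting_algebra (splitting_act s) (splitting_act_monoid_morphism s).

Lemma splitting_act_root s i :
  splitting_act s (univ_root i) = univ_root (s^-1%g i).
Proof. by rewrite splitting_actE /msym mmapX mmap1U. Qed.

End SplittingAlgebra.

Arguments splitting_algebra {A} n f.
Arguments univ_root {A n} f i.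
Arguments splitting_act {A n f} s x.

(* Main.v *)
Require Import Defs.
From HB Require Import structures.
From mathcomp Require Import all_boot all_order all_fingroup all_algebra ring.

Set Implicit Arguments.
Unset Strict Implicit.
Unset Printing Implicit Defensive.

Import GRing.Theory.

Local Open Scope ring_scope.

(** Let the splitting algebra of f be S, with universal roots r_0, r_1, and so
    on. Adjoin the first root alone: B = A[X]/(f), with t the class of X, and
    f = f1 (X - t) over B. By the universal property S is also the splitting
    algebra over B of the cofactor f1, with roots r_1, r_2, and so on. This
    makes every statement below an induction on the degree, and a first
    consequence is that A embeds into S, since A embeds into B.

    Let x in S be invariant. It is invariant under the permutations that fix
    r_0, so by induction it comes from some y in B, and y = q(t) for a
    polynomial q over A of degree less than n = deg f. Hence x = q(r_0), which
    settles the case n = 1. Otherwise transposing roots gives x = q(r_1). So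
    q(X) - y is a polynomial over B, of degree at most n - 1 = deg f1, with
    the root r_1 of f1; since B[X]/(f1) embeds into S, it equals b f1, where b
    in A is the coefficient of X^(n-1) in q. The whole theorem thus reduces to
    b = 0: then q(X) = y in B[X], and comparing constant coefficients shows
    that y, hence x, lies in A.

    To see what b can be, compare the coefficients of X^(n-2). That of f1 is
    t + c with c in A. If n > 2, that of q(X) - y is in A, so b t is in A and
    b = 0, because 1 and t are independent over A. If n = 2, that of q(X) - y
    is the sum of -b t and an element of A, so 2 b t is in A and 2 b = 0; this
    gives b = 0 if 2 is regular, a property that passes from A to the free
    A-module B. Alternatively, when n = 2, the equality q(r_0) = q(r_1) reads
    b (r_0 - r_1) = 0, which gives b = 0 if r_0 - r_1 is regular, as it is when
    the product of all the differences of roots is.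

    The universal property (is_splitting) is kept by passage from A to B
    (is_splitting_tail); the two arguments above are is_splitting_root_multiple
    and cofactor_multiple_lead, assembled in invariant_in_base. *)

(** * Adjoining one root *)

(** The quotient A[X]/(f) for f monic of degree n, described by what is used
    of it: it is free over A on the powers of t of exponent less than n, and
    universal among the A-algebras with a root of f. *)
Record adjoins_root (A B : comNzRingType) (n : nat) (f : {poly A})
    (iota : {rmorphism A -> B}) (t : B) : Prop := {
  adjoins_root_root : root (map_poly iota f) t;
  adjoins_root_span : forall y : B, exists2 q : {poly A},
    (size q <= n)%N & y = (map_poly iota q).[t];
  adjoins_root_free : forall q : {poly A},
    (size q <= n)%N -> (map_poly iota q).[t] = 0 -> q = 0;
  adjoins_root_lift : forall (T : comNzRingType) (h : {rmorphism A -> T})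
      (u : T), root (map_poly h f) u ->
    exists2 k : {rmorphism B -> T}, k \o iota =1 h & k t = u
}.

Lemma exists_adjoins_root (A : comNzRingType) (n : nat) (f : {poly A}) :
  f \is monic -> size f = n.+2 ->
  exists (B : comNzRingType) (iota : {rmorphism A -> B}) (t : B),
    adjoins_root n.+1 f iota t.
Proof.
move=> f_mon sf.
have mkE : mk_monic f = f by rewrite /mk_monic sf f_mon.
pose B : comNzRingType := {poly %/ f}.
pose iota : {rmorphism A -> B} := qpolyC f.
pose t : B := in_qpoly f 'X.
have evalE (q : {poly A}) : (map_poly iota q).[t] = in_qpoly f q.
  elim/poly_ind: q => [|q c IHq]; first by rewrite !rmorph0 horner0.
  rewrite !rmorphD !rmorphM /= map_polyX map_polyC hornerMXaddC IHq.
  congr (_ + _); apply: val_inj; rewrite /= Pdiv.CommonRing.rmodp_small //.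
  by rewrite (leq_ltn_trans (size_polyC_leq1 _)) ?size_mk_monic_gt1.
have valE (q : {poly A}) :
    val (in_qpoly f q) = Pdiv.CommonRing.rmodp q f by rewrite /= mkE.
have szB (y : B) : (size (val y) <= n.+1)%N.
  by rewrite (leq_trans (size_npoly y)) // mkE sf.
have valK (y : B) : in_qpoly f (val y) = y.
  by apply: val_inj; rewrite valE Pdiv.CommonRing.rmodp_small // sf ltnS szB.
exists B, iota, t; split.
- rewrite /root evalE; apply/eqP/val_inj; rewrite valE.
  exact: Pdiv.RingMonic.rmodpp f_mon.
- by move=> y; exists (val y); rewrite ?szB // evalE valK.
- move=> q sq; rewrite evalE => /(congr1 val).
  by rewrite valE Pdiv.CommonRing.rmodp_small // sf ltnS.
move=> T h u /eqP fu0.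
pose k (y : B) : T := (map_poly h (val y)).[u].
have kE (q : {poly A}) : k (in_qpoly f q) = (map_poly h q).[u].
  rewrite /k valE [in RHS](Pdiv.RingMonic.rdivp_eq f_mon q).
  by rewrite rmorphD rmorphM hornerD hornerM fu0 mulr0 add0r.
have k_zmod : zmod_morphism k.
  by move=> x y; rewrite /k /= rmorphB hornerD hornerN.
have k_mul : monoid_morphism k.
  split=> [|x y]; first by rewrite -(rmorph1 (in_qpoly f)) kE rmorph1 hornerC.
  by rewrite -(valK x) -(valK y) -rmorphM !kE rmorphM hornerM.
pose kZ := GRing.isZmodMorphism.Build B T k k_zmod.
pose kM := GRing.isMonoidMorphism.Build B T k k_mul.
pose K : {rmorphism B -> T} := HB.pack k kZ kM.
exists K => [a|] /=.
  by rewrite /k /= map_polyC hornerC.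
by rewrite kE map_polyX hornerX.
Qed.

(** * Splitting algebras by their universal property *)

(** Stating the universal property for an arbitrary ring S, and not for a fixed
    construction, lets the same S serve as a splitting algebra over several
    base rings. Uniqueness of the induced morphism is what says that S is
    generated over A by the roots. *)
Record is_splitting (A S : comNzRingType) (n : nat) (f : {poly A})
    (g : {rmorphism A -> S}) (r : 'I_n -> S) : Prop := {
  is_splitting_prod : map_poly g f = \prod_(i < n) ('X - (r i)%:P);
  is_splitting_lift : forall (T : comNzRingType) (h : {rmorphism A -> T})
      (u : 'I_n -> T), map_poly h f = \prod_(i < n) ('X - (u i)%:P) ->
    exists2 k : {rmorphism S -> T}, k \o g =1 h & k \o r =1 u;
  is_splitting_uniq : forall (T : comNzRingType) (k k' : {rmorphism S -> T}),
    k \o g =1 k' \o g -> k \o r =1 k' \o r -> k =1 k'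
}.

Lemma splitting_algebra_is_splitting (A : comNzRingType) (n : nat)
    (f : {poly A}) : f \is monic -> size f = n.+1 ->
  is_splitting f (in_alg (splitting_algebra n f)) (@univ_root A n f).
Proof.
move=> f_mon sf; split; first exact: univ_root_prod.
- move=> T h u fE.
  pose k (x : splitting_algebra n f) : T := mmap h u (splitting_repr x).
  have gen0 i : mmap h u (splitting_gen f i) = 0.
    rewrite rmorphB /= mmapC /signed_coef.
    have := comring_roots_coef h u (lift ord0 i : 'I_n.+1).
    rewrite lift0 -fE coef_map => e.
    have hM x : h ((-1) ^+ i.+1 * x) = (-1) ^+ i.+1 * h x.
      by rewrite rmorphM rmorph_sign.
    by rewrite [X in _ - X]hM e mulrA -exprMn mulrNN mulr1 expr1n mul1r subrr.
  have kE p : k (splitting_proj f p) = mmap h u p.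
    apply/eqP; rewrite -subr_eq0 -rmorphB; apply/eqP.
    have : splitting_repr (splitting_proj f p) - p \in splitting_ideal n f.
      by rewrite -splitting_proj_eq splitting_reprK.
    move=> /splitting_idealP[c ->]; rewrite rmorph_sum big1 // => i _.
    by rewrite rmorphM /= gen0 mulr0.
  have k_zmod : zmod_morphism k.
    move=> x y; rewrite -(splitting_reprK x) -(splitting_reprK y).
    by rewrite -rmorphB !kE rmorphB.
  have k_mul : monoid_morphism k.
    split=> [|x y]; first by rewrite -(rmorph1 (splitting_proj f)) kE rmorph1.
    rewrite -(splitting_reprK x) -(splitting_reprK y).
    by rewrite -rmorphM !kE rmorphM.
  pose kZ := GRing.isZmodMorphism.Build _ _ k k_zmod.
  pose kM := GRing.isMonoidMorphism.Build _ _ k k_mul.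
  pose K : {rmorphism splitting_algebra n f -> T} := HB.pack k kZ kM.
  exists K => [a|i] /=.
    by rewrite -splitting_projC kE mmapC.
  by rewrite /univ_root kE mmapX mmap1U.
move=> T k k' eqA eqR x; rewrite -(splitting_reprK x).
elim/mpolyind: (splitting_repr x) => [|c m p _ _ IH]; first by rewrite !rmorph0.
rewrite !rmorphD IH -mul_mpolyC !rmorphM /= splitting_projC.
have /= -> := eqA c; congr (_ * _ + _).
rewrite mpolyXE_id !rmorph_prod; apply: eq_bigr => i _ /=; rewrite !rmorphXn.
by have /= -> := eqR i.
Qed.

(** * Adjoining the roots one at a time *)

Section Tail.
Variables (A S : comNzRingType) (n : nat) (f : {poly A}).
Variables (g : {rmorphism A -> S}) (r : 'I_n.+1 -> S).

(** A factorization of f1 over a B-algebra T, completed by the image of t,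
    is a factorization of f, and conversely a morphism from B is known by
    its restriction to A and the image of t; so the universal property of S
    over A gives the one over B. *)
Lemma is_splitting_tail (B : comNzRingType) (iota : {rmorphism A -> B})
    (t : B) : f \is monic -> size f = n.+2 ->
    is_splitting f g r -> adjoins_root n.+1 f iota t ->
  exists (f1 : {poly B}) (h : {rmorphism B -> S}),
    [/\ map_poly iota f = f1 * ('X - t%:P), f1 \is monic, size f1 = n.+1
      , h \o iota =1 g /\ h t = r ord0
      & is_splitting f1 h (r \o lift ord0)].
Proof.
move=> f_mon sf spl adj.
have [f1 eq_f1] := factor_theorem _ _ (adjoins_root_root adj).
have f1_mon : f1 \is monic.
  by have := monic_map iota f_mon; rewrite eq_f1 monicMr ?monicXsubC.
have sf1 : size f1 = n.+1.
  have := congr1 (fun P : {poly B} => size P) eq_f1.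
  rewrite size_map_poly_id0 ?(monicP f_mon) ?rmorph1 ?oner_neq0 // sf.
  by rewrite size_Mmonic ?monicXsubC ?monic_neq0 // size_XsubC addn2 => -[].
have r0 : root (map_poly g f) (r ord0).
  rewrite (is_splitting_prod spl) /root big_ord_recl hornerM hornerXsubC.
  by rewrite subrr mul0r.
have [h hg ht] := adjoins_root_lift adj r0.
exists f1, h; split=> //; split.
- apply: (monic_rreg (monicXsubC (r ord0))).
  transitivity (map_poly h (f1 * ('X - t%:P))).
    by rewrite rmorphM rmorphB /= map_polyX map_polyC /= ht.
  rewrite -eq_f1 -map_poly_comp (eq_map_poly hg) (is_splitting_prod spl).
  by rewrite big_ord_recl mulrC.
- move=> T k u kE.
  pose v (i : 'I_n.+1) : T := if unlift ord0 i is Some j then u j else k t.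
  have vE : map_poly (k \o iota) f = \prod_(i < n.+1) ('X - (v i)%:P).
    rewrite map_poly_comp eq_f1 rmorphM /= kE big_ord_recl {1}/v unlift_none.
    rewrite mulrC rmorphB /= map_polyX map_polyC; congr (_ * _).
    by apply: eq_bigr => i _; rewrite /v liftK.
  have [K Kg Kr] := is_splitting_lift spl (h := k \o iota) vE.
  exists K => [y|i] /=; last first.
    by have /= -> := Kr (lift ord0 i); rewrite /v liftK.
  have [q _ ->] := adjoins_root_span adj y.
  rewrite -!horner_map -!map_poly_comp /= ht.
  have /= -> := Kr ord0; rewrite /v unlift_none.
  congr (_.[_]); apply: eq_map_poly => a /=.
  by have /= -> := hg a; have /= -> := Kg a.
move=> T k k' eqB eqR; apply: (is_splitting_uniq spl) => [a|i] /=.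
  by have /= <- := hg a; exact: (eqB (iota a)).
have [j ->|->] := unliftP ord0 i; first exact: (eqR j).
by rewrite -ht; exact: (eqB t).
Qed.

End Tail.

Lemma is_splitting0 (A S : comNzRingType) (f : {poly A})
    (g : {rmorphism A -> S}) (r : 'I_0 -> S) :
  f \is monic -> size f = 1%N -> is_splitting f g r -> bijective g.
Proof.
move=> f_mon sf spl.
have f1 : f = 1.
  have /size_poly1P[c _ ef] : size f == 1%N by rewrite sf.
  by move: f_mon; rewrite ef monicE lead_coefC => /eqP->.
have [|k kg _] := is_splitting_lift spl (h := idfun) (u := fun=> 0).
  by rewrite f1 rmorph1 big_ord0.
exists k => // x.
apply: (is_splitting_uniq spl (k := g \o k) (k' := idfun)) => [a|[]//] /=.
by have /= -> := kg a.
Qed.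

(** The map from A to S factors through A[X]/(f), into which A embeds. *)
Lemma is_splitting_inj (A S : comNzRingType) (n : nat) (f : {poly A})
    (g : {rmorphism A -> S}) (r : 'I_n -> S) :
  f \is monic -> size f = n.+1 -> is_splitting f g r -> injective g.
Proof.
elim: n A f g r => [|n IHn] A f g r f_mon sf spl.
  exact: bij_inj (is_splitting0 f_mon sf spl).
have [B [iota [t adj]]] := exists_adjoins_root f_mon sf.
have [f1 [h [_ f1_mon sf1 [hg _] spl1]]] := is_splitting_tail f_mon sf spl adj.
have h_inj := IHn _ _ _ _ f1_mon sf1 spl1.
apply: raddf_inj => a; have /= <- := hg a; rewrite -(rmorph0 h) => /h_inj ia0.
apply/eqP; rewrite -polyC_eq0; apply/eqP/(adjoins_root_free adj).
  exact: leq_trans (size_polyC_leq1 _) _.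
by rewrite map_polyC hornerC.
Qed.

(** * Invariants *)

(** Subtracting from P the multiple of f that cancels its coefficient of degree
    deg f leaves a polynomial of degree less than deg f with the root r_0; and
    r_0 satisfies no nontrivial equation of degree less than deg f over A,
    because A[X]/(f) embeds into S. *)
Lemma is_splitting_root_multiple (A S : comNzRingType) (n : nat) (f : {poly A})
    (g : {rmorphism A -> S}) (r : 'I_n.+1 -> S) (P : {poly A}) :
    f \is monic -> size f = n.+2 -> is_splitting f g r ->
    (size P <= n.+2)%N -> root (map_poly g P) (r ord0) ->
  P = P`_n.+1 *: f.
Proof.
move=> f_mon sf spl sP /eqP P_root.
have [B [iota [t adj]]] := exists_adjoins_root f_mon sf.
have [f1 [h [_ f1_mon sf1 [hg ht] spl1]]] := is_splitting_tail f_mon sf spl adj.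
have h_inj := is_splitting_inj f1_mon sf1 spl1.
have Pt : (map_poly iota P).[t] = 0.
  apply: h_inj; rewrite rmorph0 -horner_map ht -map_poly_comp.
  by rewrite (eq_map_poly hg).
apply/eqP; rewrite -subr_eq0; apply/eqP/(adjoins_root_free adj).
  apply/leq_sizeP=> j; rewrite leq_eqVlt => /orP[/eqP<-|lt_nj].
    rewrite coefB coefZ; have := f_mon.
    by rewrite monicE lead_coefE sf => /eqP->; rewrite mulr1 subrr.
  rewrite coefB coefZ (nth_default _ (leq_trans sP lt_nj)).
  by rewrite [f`_j]nth_default ?sf // mulr0 subrr.
rewrite rmorphB /= map_polyZ hornerD hornerN hornerZ Pt.
by rewrite (eqP (adjoins_root_root adj)) mulr0 subr0.
Qed.

(** Transpositions carry the value at one root to the value at any other one;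
    the endomorphism inducing a transposition comes from the universal
    property, since permuting the roots does not change their factorization. *)
Lemma invariant_root_eval (A S : comNzRingType) (n : nat) (f : {poly A})
    (g : {rmorphism A -> S}) (r : 'I_n -> S) (x : S) (q : {poly A})
    (i j : 'I_n) :
    is_splitting f g r ->
    (forall (s : 'S_n) (k : {rmorphism S -> S}),
       k \o g =1 g -> k \o r =1 r \o s -> k x = x) ->
  x = (map_poly g q).[r j] -> x = (map_poly g q).[r i].
Proof.
move=> spl inv eq_x; pose s : 'S_n := tperm j i.
have [|k kg kr] := is_splitting_lift spl (h := g) (u := r \o s).
  by rewrite (is_splitting_prod spl) (reindex_inj (@perm_inj _ s)).
rewrite -(inv s k kg kr) eq_x -horner_map -map_poly_comp (eq_map_poly kg).
by have /= -> := kr j; rewrite tpermL.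
Qed.

Lemma adjoins_root_linear_free (A B : comNzRingType) (n : nat) (f : {poly A})
    (iota : {rmorphism A -> B}) (t : B) (a b : A) :
  adjoins_root n.+2 f iota t -> iota a + iota b * t = 0 -> b = 0.
Proof.
move=> adj ab0; suff /(congr1 (fun p : {poly A} => p`_1)) : b *: 'X + a%:P = 0.
  by rewrite coefD coefZ coefX coefC mulr1 addr0 coef0.
apply: (adjoins_root_free adj).
  rewrite (leq_trans (size_polyD _ _)) // geq_max.
  rewrite (leq_trans (size_scale_leq _ _)) ?size_polyX //.
  exact: leq_trans (size_polyC_leq1 _) _.
rewrite rmorphD /= map_polyZ /= map_polyX map_polyC.
by rewrite hornerD hornerZ hornerX hornerC addrC.
Qed.

(** Comparing the coefficients of X^n, where that of f1 is f_(n+1) + t. If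
    n > 0 the left-hand side contributes an element of A and the equation is
    linear in t with leading coefficient the top coefficient of q; if n = 0
    the constant q(t) contributes a second multiple of t, which is why only
    twice that coefficient has to vanish. *)
Lemma cofactor_multiple_lead (A B : comNzRingType) (n : nat) (f : {poly A})
    (iota : {rmorphism A -> B}) (t : B) (f1 : {poly B}) (q : {poly A}) :
    adjoins_root n.+2 f iota t ->
    map_poly iota f = f1 * ('X - t%:P) -> f1 \is monic -> size f1 = n.+2 ->
    (size q <= n.+2)%N ->
    map_poly iota q - (map_poly iota q).[t]%:P = iota q`_n.+1 *: f1 ->
  q`_n.+1 *+ 2 = 0 /\ ((0 < n)%N -> q`_n.+1 = 0).
Proof.
move=> adj eq_f1 f1_mon sf1 sq.
set b := q`_n.+1 => /(congr1 (fun p : {poly B} => p`_n)).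
have f1_lead : f1`_n.+1 = 1.
  by have := f1_mon; rewrite monicE lead_coefE sf1 => /eqP.
have f1_sub : f1`_n = iota f`_n.+1 + t.
  have := congr1 (fun p : {poly B} => p`_n.+1) eq_f1.
  rewrite /= coef_map mulrBr coefB coefMX coefMC f1_lead mul1r => ->.
  by rewrite subrK.
rewrite coefB coefZ coef_map coefC f1_sub /=.
have [n0|n_gt0] := posnP n.
  subst n.
  rewrite (horner_coef_wide t (n := 2)) ?(leq_trans (size_poly _ _)) //.
  rewrite !big_ord_recl big_ord0 /= !coef_map /= -/b => e; split=> //.
  apply: (adjoins_root_linear_free adj (a := b * f`_1)).
  rewrite rmorphM rmorphMn; move: e => /eqP; rewrite -subr_eq0 => /eqP e.
  rewrite -[RHS]oppr0 -e; ring.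
rewrite subr0 => e.
suff b0 : b = 0 by rewrite b0 mul0rn.
apply: (adjoins_root_linear_free adj (a := b * f`_n.+1 - q`_n)).
by rewrite rmorphB rmorphM e; ring.
Qed.

(** Invariance is expressed through all the endomorphisms of S over A that
    permute the roots, so that it passes to a larger base ring without
    constructing an action there. Regularity of 2 is asked in the base ring,
    regularity of the differences of roots in S: both pass from A to B. *)
Lemma invariant_in_base (A S : comNzRingType) (n : nat) (f : {poly A})
    (g : {rmorphism A -> S}) (r : 'I_n -> S) (x : S) :
    f \is monic -> size f = n.+1 -> is_splitting f g r ->
    (forall a : A, a *+ 2 = 0 -> a = 0) \/
    (forall i j, i != j -> forall y : S, y * (r i - r j) = 0 -> y = 0) ->
    (forall (s : 'S_n) (k : {rmorphism S -> S}),
       k \o g =1 g -> k \o r =1 r \o s -> k x = x) ->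
  exists a : A, x = g a.
Proof.
elim: n A f g r => [|n IHn] A f g r f_mon sf spl reg inv.
  have [k _ gK] := is_splitting0 f_mon sf spl.
  by exists (k x); rewrite gK.
have [B [iota [t adj]]] := exists_adjoins_root f_mon sf.
have [f1 [h [eq_f1 f1_mon sf1 [hg ht] spl1]]] :=
  is_splitting_tail f_mon sf spl adj.
have [||y eq_x] := IHn _ _ _ _ f1_mon sf1 spl1.
- case: reg => [reg2|regr]; [left=> y | right=> i j ne_ij z].
    have [q sq ->] := adjoins_root_span adj y.
    rewrite -hornerMn -rmorphMn => /(adjoins_root_free adj) q2.
    suff -> : q = 0 by rewrite rmorph0 horner0.
    apply/polyP=> i; rewrite coef0; apply: reg2.
    rewrite -coefMn q2 ?coef0 //; apply: leq_trans sq.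
    by rewrite mulr2n (leq_trans (size_polyD _ _)) // maxnn.
  by apply: regr; rewrite (inj_eq lift_inj).
- move=> s k kh kr.
  (* A permutation of the remaining roots extends to one fixing r_0 = h t. *)
  apply: (inv (lift_perm ord0 ord0 s)) => [a|i] /=.
    by have /= <- := hg a; exact: kh.
  have [j ->|->] := unliftP ord0 i; first by rewrite lift_perm_lift; exact: kr.
  by rewrite lift_perm_id -ht; exact: kh.
have [q sq eq_y] := adjoins_root_span adj y.
(* If f has degree one, q is a constant polynomial. *)
case: n => [|n] in f1 IHn r f_mon sf spl reg inv adj eq_f1 f1_mon sf1 ht spl1
  sq *.
  exists q`_0; have /= <- := hg q`_0.
  by rewrite eq_x eq_y [q in LHS]size1_polyC // map_polyC hornerC.
have rootE i : x = (map_poly g q).[r i].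
  apply: (invariant_root_eval i spl inv (j := ord0)).
  rewrite eq_x eq_y -horner_map ht -map_poly_comp.
  by rewrite (eq_map_poly hg).
have eq_P : map_poly iota q - y%:P = iota q`_n.+1 *: f1.
  have -> : iota q`_n.+1 = (map_poly iota q - y%:P)`_n.+1.
    by rewrite coefB coef_map coefC subr0.
  apply: (is_splitting_root_multiple f1_mon sf1 spl1).
    rewrite (leq_trans (size_polyD _ _)) // geq_max size_polyN.
    by rewrite (leq_trans (size_poly _ _)) // (leq_trans (size_polyC_leq1 _)).
  rewrite /root rmorphB /= map_polyC hornerD hornerN hornerC /=.
  by rewrite -map_poly_comp (eq_map_poly hg) -rootE eq_x; apply/eqP/subrr.
suff q_lead0 : q`_n.+1 = 0.
  exists q`_0; have /= <- := hg q`_0; rewrite eq_x; congr (h _).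
  have := congr1 (fun p : {poly B} => p`_0) eq_P.
  rewrite q_lead0 rmorph0 scale0r coef0 coefB coef_map coefC /=.
  by move/eqP; rewrite subr_eq0 => /eqP.
have := cofactor_multiple_lead adj eq_f1 f1_mon sf1 sq.
rewrite -eq_y => /(_ eq_P)[q2 qn0].
have [n0|/qn0//] := posnP n.
(* Two roots remain: q(X) = q_0 + q_1 X takes the same value at both. *)
case: reg => [reg2|regr]; first exact: reg2.
subst n; have g_inj := is_splitting_inj f_mon sf spl.
apply: g_inj; rewrite rmorph0; apply: (regr ord0 (lift ord0 ord0)) => //.
have qE u : (map_poly g q).[u] = g q`_0 + g q`_1 * u.
  rewrite (horner_coef_wide u (n := 2)) ?(leq_trans (size_poly _ _)) //.
  by rewrite !big_ord_recl big_ord0 /= !coef_map expr0 expr1 mulr1 addr0.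
have := rootE ord0; rewrite (rootE (lift ord0 ord0)) !qE => /addrI e.
by rewrite mulrBr e subrr.
Qed.

Theorem theorem3p1 (A : comNzRingType) (n : nat) (n_ge1 : (1 <= n)%N)
    (f : {poly A}) (f_monic : f \is monic) (deg_f : size f = n.+1)
    (H : regular (2%:R : A) \/
         regular (\prod_(ij : 'I_n * 'I_n | ij.1 != ij.2)
                    (univ_root f ij.1 - univ_root f ij.2))) :
  injective (in_alg (splitting_algebra n f)) /\
  (forall x : splitting_algebra n f,
     (forall s : 'S_n, splitting_act s x = x) <-> (exists a : A, x = a%:A)).
Proof.
have spl := splitting_algebra_is_splitting f_monic deg_f.
split; first exact: is_splitting_inj f_monic deg_f spl.
move=> x; split=> [inv|[a ->] s]; last first.
  by rewrite linearZ /= rmorph1.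
apply: (invariant_in_base f_monic deg_f spl).
  case: H => [[_ reg]|[_ reg]]; [left=> a a2 | right=> i j ne_ij y yij].
    apply/eqP; apply: contra_notT reg => /eqP a_neq0; exists a; split=> //.
    by rewrite mulr_natl.
  apply/eqP; apply: contra_notT reg => /eqP y_neq0; exists y; split=> //.
  by rewrite (bigD1 (i, j)) //= mulrC mulrA yij mul0r.
move=> s k kA kR; rewrite -[RHS](inv s^-1%g).
apply: (is_splitting_uniq spl) => [a|i] /=.
  by have /= -> := kA a; rewrite linearZ /= rmorph1.
by have /= -> := kR i; rewrite splitting_act_root invgK.
Qed.
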